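(* Let $G = \langle X \mid Y\rangle$ be a group with set of generators $X$ and set of relators $Y$, let $R$ be a commutative unital ring, and let $\sigma$ be an $R$-algebra endomorphism of the group ring $RG$ which is an $R$-linear extension of a group endomorphism of $G$. Let $f: X \to RG$ be a map and let $\tilde f: F(X)\to RG$ be its associated extension to the free group $F(X)$ on $X$ (defined in the context). Then $f$ can be extended to a $\sigma$-derivation $D$ of $RG$ if and only if $\tilde f(y) = 0$ for all $y \in Y$.
   Context: A $\sigma$-derivation of $RG$ is an $R$-linear map $D: RG\to RG$ with $D(\alpha\beta) = D(\alpha)\sigma(\beta)+\sigma(\alpha)D(\beta)$ for all $\alpha,\beta\in RG$. $D$ extends $f$ if $D(x)=f(x)$ for all $x\in X$ (where $x$ is viewed as an element of $G\subseteq RG$). Let $F(X)$ be the free group on $X$, so that $Y\subseteq F(X)$ and $G\cong F(X)/Y^{F(X)}$, where $Y^{F(X)}$ is the normal closure of $Y$. Let $\tilde\sigma: F(X)\to G$ be the unique group homomorphism with $\tilde\sigma(x)=\sigma(x)$ for all $x\in X$. The map $\tilde f: F(X)\to RG$ is the unique map with $\tilde f(x)=f(x)$ for $x\in X$ and $\tilde f(vw)=\tilde f(v)\tilde\sigma(w)+\tilde\sigma(v)\tilde f(w)$ for all $v,w\in F(X)$. Explicitly, $\tilde f(1)=0$, $\tilde f(x)=f(x)$ and $\tilde f(x^{-1})=-\tilde\sigma(x^{-1})f(x)\tilde\sigma(x^{-1})$ for $x\in X$, and for $w=x_1\cdots x_m$ with $x_i\in X\cup X^{-1}$, $\tilde f(w)=\sum_{i=1}^m\left(\prod_{j=1}^{i-1}\tilde\sigma(x_j)\right)\tilde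 f(x_i)\left(\prod_{j=i+1}^m\tilde\sigma(x_j)\right)$. *)

(* Defs.v *)
From HB Require Import structures.
From mathcomp Require Import all_boot all_order all_algebra finmap.
From mathcomp.multinomials Require Import monalg.

Set Implicit Arguments.
Unset Strict Implicit.
Unset Printing Implicit Defensive.

Import GRing.Theory.

(* Letters of free-group words: (x, false) encodes x and (x, true) its inverse. *)

Section ReducedWords.
Variable X : eqType.
Implicit Types (a b : X * bool) (u v w : seq (X * bool)).

Definition linv a : X * bool := (a.1, ~~ a.2).

Definition reduced w := sorted (fun a b => b != linv a) w.

Definition cons_free a w :=
  if w is b :: w' then if b == linv a then w' else a :: w else [:: a].

Definition wmul u v := foldr cons_free v u.

Definition winv w := rev (map linv w).

Lemma linvK : involutive linv.
Proof. by case=> x e; rewrite /linv /= negbK. Qed.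

Lemma reduced_behead a w : reduced (a :: w) -> reduced w.
Proof. by case: w => //= b w /andP[]. Qed.

Lemma reduced_cons_free a w : reduced w -> reduced (cons_free a w).
Proof.
case: w => //= b w; case: ifPn => [_|nb] rw; last by rewrite /= nb.
exact: reduced_behead rw.
Qed.

Lemma reduced_wmul u v : reduced v -> reduced (wmul u v).
Proof. by move=> rv; elim: u => //= a u; apply: reduced_cons_free. Qed.

Lemma cons_freeK a w : reduced w -> cons_free (linv a) (cons_free a w) = w.
Proof.
case: w => [|b w] /=; first by rewrite linvK eqxx.
case: eqP => [->|_] rw /=; last by rewrite linvK eqxx.
by case: w rw => //= c w /andP[/negPf-> _].
Qed.

Lemma cons_freeKV a w : reduced w -> cons_free a (cons_free (linv a) w) = w.
Proof. by move=> rw; rewrite -{1}[a]linvK cons_freeK. Qed.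

Lemma wmul_cons_free a w v : reduced v ->
  wmul (cons_free a w) v = cons_free a (wmul w v).
Proof.
move=> rv; case: w => //= b w; case: eqP => //= ->.
by rewrite cons_freeKV // reduced_wmul.
Qed.

Lemma wmulA u v w : reduced w -> wmul u (wmul v w) = wmul (wmul u v) w.
Proof. by move=> rw; elim: u => //= a u ->; rewrite wmul_cons_free. Qed.

Lemma wmulw1 w : reduced w -> wmul w [::] = w.
Proof.
elim: w => //= a w IHw rw; rewrite IHw; last exact: reduced_behead rw.
by case: w rw {IHw} => //= b w /andP[/negPf->].
Qed.

Lemma wmulKV u v : reduced v -> wmul (winv u) (wmul u v) = v.
Proof.
move=> rv; elim: u => //= a u IHu.
rewrite /winv /= rev_cons /wmul -cats1 foldr_cat /=.
by rewrite cons_freeK ?reduced_wmul.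
Qed.

Lemma winvK : involutive winv.
Proof. by move=> w; rewrite /winv map_rev revK mapK //; apply: linvK. Qed.

Lemma reduced_winv w : reduced w -> reduced (winv w).
Proof.
rewrite /reduced /winv rev_sorted sorted_map => rw.
by apply: sub_sorted rw => a b; rewrite /= linvK eq_sym.
Qed.

End ReducedWords.

Record freeGroup (X : choiceType) := FreeGroup {
  fg_word :> seq (X * bool);
  fg_wordP : reduced fg_word
}.

Section FreeGroup.
Variable X : choiceType.

HB.instance Definition _ := [isSub for @fg_word X].
HB.instance Definition _ := [Choice of freeGroup X by <:].

Implicit Types u v w : freeGroup X.

Definition fg_one : freeGroup X := @FreeGroup X [::] isT.
Definition fg_mul u v : freeGroup X :=
  FreeGroup (reduced_wmul u (fg_wordP v)).
Definition fg_inv w : freeGroup X := FreeGroup (reduced_winv (fg_wordP w)).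

Fact fg_mulA : associative fg_mul.
Proof. by move=> u v w; apply: val_inj; apply: wmulA (fg_wordP w). Qed.

Fact fg_mul1 : left_id fg_one fg_mul.
Proof. by move=> w; apply: val_inj. Qed.

Fact fg_mulg1 : right_id fg_one fg_mul.
Proof. by move=> w; apply: val_inj; apply: wmulw1 (fg_wordP w). Qed.

Fact fg_mulV : left_inverse fg_one fg_inv fg_mul.
Proof.
move=> w; apply: val_inj => /=.
by rewrite -{2}[fg_word w]wmulw1 ?wmulKV // fg_wordP.
Qed.

Fact fg_invK : involutive fg_inv.
Proof. by move=> w; apply: val_inj; apply: winvK. Qed.

Fact fg_mulgV : right_inverse fg_one fg_inv fg_mul.
Proof. by move=> w; rewrite -{1}[w]fg_invK fg_mulV. Qed.

HB.instance Definition _ := isGroup.Build (freeGroup X)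
  fg_mulA fg_mul1 fg_mulg1 fg_mulV fg_mulgV.

Definition fg_gen (x : X) : freeGroup X := @FreeGroup X [:: (x, false)] isT.

End FreeGroup.

Section FreeGroupLift.
Variables (X : choiceType) (G : groupType) (h : X -> G).
Local Open Scope group_scope.

Definition letter_val (a : X * bool) : G := if a.2 then (h a.1)^-1 else h a.1.

Definition fg_lift (w : freeGroup X) : G := \prod_(a <- w) letter_val a.

Lemma letter_valV a : letter_val (linv a) = (letter_val a)^-1.
Proof. by case: a => x [] //=; rewrite /letter_val /= invgK. Qed.

Lemma prod_wmul (u v : seq (X * bool)) :
  \prod_(a <- wmul u v) letter_val a =
  (\prod_(a <- u) letter_val a) * (\prod_(a <- v) letter_val a).
Proof.
elim: u => [|a u IHu] /=; first by rewrite big_nil mul1g.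
rewrite big_cons -mulgA -IHu; case: (wmul u v) => [|b w] /=.
  by rewrite big_cons.
case: eqP => [->|_]; last by rewrite !big_cons.
by rewrite !big_cons letter_valV mulgA mulgV mul1g.
Qed.

Fact fg_lift_morphM : {morph fg_lift : u v / u * v}.
Proof. by move=> u v; apply: prod_wmul. Qed.

Fact fg_lift_monoid_morphism : monoid.monoid_morphism fg_lift.
Proof. by split; [exact: big_nil | exact: fg_lift_morphM]. Qed.

HB.instance Definition _ :=
  isUMagmaMorphism.Build (freeGroup X) G fg_lift fg_lift_monoid_morphism.

Lemma fg_lift_gen x : fg_lift (fg_gen x) = h x.
Proof. by rewrite /fg_lift /= big_seq1. Qed.

End FreeGroupLift.

Lemma fg_ind (X : choiceType) (P : freeGroup X -> Prop) :
    P 1%g ->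
    (forall x w, P w -> P (fg_gen x * w)%g) ->
    (forall x w, P w -> P ((fg_gen x)^-1 * w)%g) ->
  forall w, P w.
Proof.
move=> P1 PM PV [w rw]; elim: w rw => [|[x e] w IHw] rw.
  by rewrite (_ : FreeGroup rw = 1%g) //; apply: val_inj.
have rw' := reduced_behead rw; have := IHw rw'.
have redE : cons_free (x, e) w = (x, e) :: w.
  by case: w rw {IHw rw'} => //= b w /andP[/negPf->].
case: e rw redE => rw redE Pw.
  rewrite (_ : FreeGroup rw = (fg_gen x)^-1 * FreeGroup rw')%g; first exact: PV.
  by apply: val_inj; rewrite /= -redE.
rewrite (_ : FreeGroup rw = fg_gen x * FreeGroup rw')%g; first exact: PM.
by apply: val_inj; rewrite /= -redE.
Qed.

Section Presentation.
Local Open Scope group_scope.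

Record normal_subgroup (G : groupType) (N : G -> Prop) : Prop := {
  normal1 : N 1;
  normalM : forall x y, N x -> N y -> N (x * y);
  normalV : forall x, N x -> N x^-1;
  normalJ : forall x y, N x -> N (x ^ y)
}.

Definition normal_closure (G : groupType) (Y : G -> Prop) (g : G) : Prop :=
  forall N : G -> Prop,
    normal_subgroup N -> (forall y, Y y -> N y) -> N g.

(* gen sends each generator to its image in G; the two conditions say that *)
(* it induces an isomorphism from F(X) / normal_closure Y onto G.          *)
Definition is_presentation (X : choiceType) (G : groupType)
    (gen : X -> G) (Y : freeGroup X -> Prop) : Prop :=
  (forall g, exists w, fg_lift gen w = g) /\
  (forall w, fg_lift gen w = 1 <-> normal_closure Y w).

End Presentation.

(* The ring structure of {malg R[K]} in monalg requires the only unit of  *)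
(* K to be 1, and R to be nontrivial; group rings need neither.           *)
Definition groupRing (R : pzRingType) (G : groupType) : Type := {malg R[G]}.

Local Open Scope ring_scope.

Section GroupRing.
Variables (R : pzRingType) (G : groupType).
Local Notation RG := (groupRing R G).
Implicit Types (c : R) (g h k : G) (p q r : RG).

HB.instance Definition _ := GRing.Zmodule.on RG.

Definition gr_scale c p : RG := \sum_(k <- msupp p) << c * p@_k *g k >>.

Lemma gr_scaleE c p k : (gr_scale c p : RG)@_k = c * p@_k.
Proof.
rewrite {2}[p]monalgE !raddf_sum mulr_sumr.
by apply/eq_bigr=> /= i _; rewrite !mcoeffU mulrnAr.
Qed.

Fact gr_scaleA a b p : gr_scale a (gr_scale b p) = gr_scale (a * b) p.
Proof. by apply/malgP=> x; rewrite !gr_scaleE mulrA. Qed.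

Fact gr_scale1 : left_id 1 gr_scale.
Proof. by move=> p; apply/malgP=> k; rewrite gr_scaleE mul1r. Qed.

Fact gr_scaleDr : right_distributive gr_scale +%R.
Proof.
by move=> c p q; apply/malgP=> k; rewrite !(mcoeffD, gr_scaleE) mulrDr.
Qed.

Fact gr_scaleDl p : {morph gr_scale^~ p : a b / a + b}.
Proof. by move=> a b; apply/malgP=> k; rewrite !(mcoeffD, gr_scaleE) mulrDl. Qed.

HB.instance Definition _ := GRing.Zmodule_isLmodule.Build R RG
  gr_scaleA gr_scale1 gr_scaleDr gr_scaleDl.

Definition gr_one : RG := << 1 *g 1%g >>.

Definition gr_mul p q : RG :=
  \sum_(k1 <- msupp p) \sum_(k2 <- msupp q) << p@_k1 * q@_k2 *g (k1 * k2)%g >>.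

Lemma gr_mulw (d1 d2 : {fset G}) p q :
  (msupp p `<=` d1)%fset -> (msupp q `<=` d2)%fset ->
  gr_mul p q =
  \sum_(k1 <- d1) \sum_(k2 <- d2) << p@_k1 * q@_k2 *g (k1 * k2)%g >>.
Proof.
move=> le_d1 le_d2; rewrite /gr_mul (big_fset_incl _ le_d1) /=.
  apply/eq_bigr=> k1 _; apply/big_fset_incl => // k _ /mcoeff_outdom ->.
  by rewrite mulr0 monalgU0.
move=> k _ /mcoeff_outdom pk.
by rewrite big1 => // k' _; rewrite pk mul0r monalgU0.
Qed.

Lemma gr_mulUU c1 c2 k1 k2 :
  gr_mul << c1 *g k1 >> << c2 *g k2 >> = << c1 * c2 *g (k1 * k2)%g >>.
Proof. by rewrite (gr_mulw msuppU_le msuppU_le) !big_seq_fset1 !mcoeffUU. Qed.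

Fact gr_mulDl : left_distributive gr_mul +%R.
Proof.
move=> p q r; rewrite (gr_mulw (msuppD_le p q) (fsubset_refl _)).
rewrite (gr_mulw (fsubsetUl _ (msupp q)) (fsubset_refl (msupp r))).
rewrite (gr_mulw (fsubsetUr (msupp p) _) (fsubset_refl (msupp r))).
rewrite -big_split /=; apply/eq_bigr=> k1 _.
rewrite -big_split /=; apply/eq_bigr=> k2 _.
by rewrite mcoeffD mulrDl monalgUD.
Qed.

Fact gr_mulDr : right_distributive gr_mul +%R.
Proof.
move=> r p q; rewrite (gr_mulw (fsubset_refl _) (msuppD_le p q)).
rewrite (gr_mulw (fsubset_refl (msupp r)) (fsubsetUl _ (msupp q))).
rewrite (gr_mulw (fsubset_refl (msupp r)) (fsubsetUr (msupp p) _)).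
rewrite -big_split /=; apply/eq_bigr=> k1 _.
rewrite -big_split /=; apply/eq_bigr=> k2 _.
by rewrite mcoeffD mulrDr monalgUD.
Qed.

Lemma gr_mul0l p : gr_mul 0 p = 0.
Proof. by rewrite /gr_mul msupp0 big_seq_fset0. Qed.

Lemma gr_mul0r p : gr_mul p 0 = 0.
Proof. by apply: big1 => k _; rewrite msupp0 big_seq_fset0. Qed.

Let gr_mul_suml I (s : seq I) (F : I -> RG) q :
  gr_mul (\sum_(i <- s) F i) q = \sum_(i <- s) gr_mul (F i) q.
Proof.
exact: (big_morph (gr_mul^~ q) (fun _ _ => gr_mulDl _ _ _) (gr_mul0l _)).
Qed.

Let gr_mul_sumr I (s : seq I) (F : I -> RG) q :
  gr_mul q (\sum_(i <- s) F i) = \sum_(i <- s) gr_mul q (F i).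
Proof.
exact: (big_morph (gr_mul q) (fun _ _ => gr_mulDr _ _ _) (gr_mul0r _)).
Qed.

Fact gr_mulA : associative gr_mul.
Proof.
move: gr_mul gr_mul_suml gr_mul_sumr gr_mulUU => mul summl summr mulUU p q r.
rewrite [p]monalgE !summl; apply: eq_bigr => k1 _.
rewrite [q]monalgE !(summl, summr); apply: eq_bigr => k2 _.
rewrite [r]monalgE !summr; apply: eq_bigr => k3 _.
by rewrite !mulUU mulrA mulgA.
Qed.

Fact gr_mul1 : left_id gr_one gr_mul.
Proof.
move=> p; rewrite {1}[p]monalgE gr_mul_sumr [RHS]monalgE.
by apply: eq_bigr => k _; rewrite gr_mulUU mul1r mul1g.
Qed.

Fact gr_mulr1 : right_id gr_one gr_mul.
Proof.
move=> p; rewrite {1}[p]monalgE gr_mul_suml [RHS]monalgE.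
by apply: eq_bigr => k _; rewrite gr_mulUU mulr1 mulg1.
Qed.

HB.instance Definition _ := GRing.Zmodule_isPzRing.Build RG
  gr_mulA gr_mul1 gr_mulr1 gr_mulDl gr_mulDr.

Definition gr_of (g : G) : RG := << 1 *g g >>.

Lemma gr_of1 : gr_of 1%g = 1.
Proof. by []. Qed.

Lemma gr_ofM g h : gr_of (g * h)%g = gr_of g * gr_of h.
Proof. by rewrite [RHS]gr_mulUU mulr1. Qed.

Lemma gr_of_prod I (s : seq I) (F : I -> G) :
  gr_of (\prod_(i <- s) F i)%g = \prod_(i <- s) gr_of (F i).
Proof. exact: (big_morph gr_of gr_ofM gr_of1). Qed.

Lemma gr_ofE p : p = \sum_(g <- msupp p) p@_g *: gr_of g.
Proof.
rewrite [LHS]monalgE; apply: eq_bigr => g _; apply/malgP=> k.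
by rewrite gr_scaleE !mcoeffU mulrnAr mulr1.
Qed.

Lemma gr_scaleU c a k : c *: (<< a *g k >> : RG) = << c * a *g k >>.
Proof. by apply/malgP=> k'; rewrite gr_scaleE !mcoeffU mulrnAr. Qed.

Lemma gr_msuppZ_le c p : (msupp (c *: p : RG) `<=` msupp p)%fset.
Proof.
apply/fsubsetP=> k; rewrite -!mcoeff_neq0 gr_scaleE.
by apply: contra_neq => ->; rewrite mulr0.
Qed.

Let gr_scale_mulE c p q : c *: (p * q) =
  \sum_(k1 <- msupp p) \sum_(k2 <- msupp q)
    << c * (p@_k1 * q@_k2) *g (k1 * k2)%g >>.
Proof.
rewrite [LHS]scaler_sumr; apply: eq_bigr => k1 _.
by rewrite scaler_sumr; apply: eq_bigr => k2 _; rewrite gr_scaleU.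
Qed.

Lemma gr_scalerAl c p q : c *: (p * q) = (c *: p) * q.
Proof.
rewrite gr_scale_mulE [RHS](gr_mulw (gr_msuppZ_le c p) (fsubset_refl _)).
by apply: eq_bigr => k1 _; apply: eq_bigr => k2 _; rewrite gr_scaleE mulrA.
Qed.

Lemma gr_scalerAr c p q :
  (forall a : R, c * a = a * c) -> c *: (p * q) = p * (c *: q).
Proof.
move=> cC; rewrite gr_scale_mulE.
rewrite [RHS](gr_mulw (fsubset_refl _) (gr_msuppZ_le c q)).
apply: eq_bigr => k1 _; apply: eq_bigr => k2 _.
by rewrite gr_scaleE !mulrA cC.
Qed.

End GroupRing.

Section Derivations.
Variables (R : comPzRingType) (G : groupType).
Local Notation RG := (groupRing R G).

(* The second condition, with linearity, says that sigma is an R-algebra  *)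
(* endomorphism; {lrmorphism _ -> _} would require R to be nontrivial.    *)
Definition linear_extension (s : {multiplicative G -> G}) (sigma : RG -> RG) :
    Prop :=
  [/\ linear sigma, GRing.monoid_morphism sigma
    & forall g, sigma (gr_of R g) = gr_of R (s g)].

Definition sigma_derivation (sigma D : RG -> RG) : Prop :=
  linear D /\ forall a b, D (a * b) = D a * sigma b + sigma a * D b.

End Derivations.

Section FTilde.
Variables (R : comPzRingType) (X : choiceType) (G : groupType).
Variables (gen : X -> G) (s : {multiplicative G -> G}).
Local Notation RG := (groupRing R G).
Variable f : X -> RG.

Definition sigma_tilde : freeGroup X -> G := fg_lift (s \o gen).

Let st (a : X * bool) : RG := gr_of R (letter_val (s \o gen) a).

Definition ftilde_letter (a : X * bool) : RG :=
  if a.2 then - (st a * f a.1 * st a) else f a.1.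

Definition ftilde (w : freeGroup X) : RG :=
  \sum_(i < size w) (\prod_(a <- take i w) st a)
     * ftilde_letter (tnth (in_tuple w) i) * (\prod_(a <- drop i.+1 w) st a).

Let fw (w : seq (X * bool)) : RG :=
  \sum_(i < size w) (\prod_(a <- take i w) st a)
     * ftilde_letter (tnth (in_tuple w) i) * (\prod_(a <- drop i.+1 w) st a).

Let sw (w : seq (X * bool)) : RG := \prod_(a <- w) st a.

Let fw_nil : fw [::] = 0.
Proof. exact: big_ord0. Qed.

Let fw_cons a w : fw (a :: w) = ftilde_letter a * sw w + st a * fw w.
Proof.
rewrite /fw /= big_ord_recl /= big_nil mul1r drop0; congr (_ + _).
rewrite mulr_sumr; apply: eq_bigr => i _.
by rewrite /= big_cons !mulrA !(tnth_nth a).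
Qed.

Let st_invr a : st a * st (linv a) = 1.
Proof. by rewrite /st -gr_ofM letter_valV mulgV. Qed.

Let ftilde_linv a :
  ftilde_letter a * st (linv a) + st a * ftilde_letter (linv a) = 0.
Proof.
case: a => x e; have := st_invr (x, e).
rewrite /ftilde_letter /linv /=; case: e => /= stK.
  by rewrite mulNr -!mulrA stK mulr1 addNr.
by rewrite mulrN !mulrA stK mul1r addrN.
Qed.

Let sw_wmul u v : sw (wmul u v) = sw u * sw v.
Proof. by rewrite /sw -!gr_of_prod prod_wmul gr_ofM. Qed.

Let fw_wmul u v : fw (wmul u v) = fw u * sw v + sw u * fw v.
Proof.
elim: u => [|a u IHu] /=.
  by rewrite fw_nil /sw big_nil mul0r add0r mul1r.
have -> : fw (cons_free a (wmul u v)) =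
          ftilde_letter a * sw (wmul u v) + st a * fw (wmul u v).
  case: (wmul u v) => [|b w] /=; first by rewrite fw_cons.
  case: eqP => [->|_]; last by rewrite fw_cons.
  rewrite fw_cons /sw big_cons mulrDr !mulrA st_invr mul1r addrA.
  by rewrite -mulrDl ftilde_linv mul0r add0r.
have swE : sw (a :: u) = st a * sw u by rewrite /sw big_cons.
by rewrite IHu sw_wmul fw_cons swE mulrDl mulrDr !mulrA !addrA.
Qed.

Lemma ftilde1 : ftilde 1%g = 0.
Proof. exact: fw_nil. Qed.

Lemma ftilde_gen x : ftilde (fg_gen x) = f x.
Proof.
by rewrite [LHS]fw_cons fw_nil mulr0 addr0 /sw big_nil mulr1.
Qed.

Lemma ftilde_genV x : ftilde (fg_gen x)^-1%g =
  - (gr_of R (sigma_tilde (fg_gen x)^-1%g) * f x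
     * gr_of R (sigma_tilde (fg_gen x)^-1%g)).
Proof.
rewrite [LHS]fw_cons fw_nil mulr0 addr0 /sw big_nil mulr1.
by rewrite /sigma_tilde /fg_lift big_seq1.
Qed.

Lemma ftildeM v w : ftilde (v * w)%g =
  ftilde v * gr_of R (sigma_tilde w) + gr_of R (sigma_tilde v) * ftilde w.
Proof. by rewrite /sigma_tilde /fg_lift !gr_of_prod; apply: fw_wmul. Qed.

Lemma ftilde_unique (g : freeGroup X -> RG) :
    (forall x, g (fg_gen x) = f x) ->
    (forall v w, g (v * w)%g =
      g v * gr_of R (sigma_tilde w) + gr_of R (sigma_tilde v) * g w) ->
  g =1 ftilde.
Proof.
move=> gX gM.
have st1 : sigma_tilde 1%g = 1%g by rewrite /sigma_tilde gmulf1.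
have g1 : g 1%g = 0.
  have := gM 1%g 1%g; rewrite mulg1 st1 gr_of1 mulr1 mul1r.
  by move/(congr1 (fun z => z - g 1%g)); rewrite addrK subrr.
have gV x : g (fg_gen x)^-1%g = ftilde (fg_gen x)^-1%g.
  have := gM (fg_gen x)^-1%g (fg_gen x); rewrite mulVg g1 gX => e.
  have := congr1 (fun z => z * gr_of R (sigma_tilde (fg_gen x)^-1%g)) e.
  rewrite /= mul0r mulrDl -mulrA -gr_ofM /sigma_tilde.
  rewrite -gmulfM mulgV gmulf1 gr_of1 mulr1 => /esym/eqP.
  by rewrite addr_eq0 => /eqP->; rewrite ftilde_genV.
elim/fg_ind=> [|x w IHw|x w IHw]; first by rewrite g1 ftilde1.
  by rewrite gM ftildeM gX ftilde_gen IHw.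
by rewrite gM ftildeM gV IHw.
Qed.

End FTilde.

(* Main.v *)
Require Import Defs.
From HB Require Import structures.
From mathcomp Require Import all_boot all_order all_algebra finmap.
From mathcomp.multinomials Require Import monalg.

Set Implicit Arguments.
Unset Strict Implicit.
Unset Printing Implicit Defensive.

Import GRing.Theory.
Local Open Scope ring_scope.

(** Let [pi : F(X) -> G] be the projection of the presentation ([fg_lift gen]).
    The theorem is the universal property of [G = F(X)/Y^F(X)], read for the
    twisted Leibniz rule [d (g h) = d g * s h + s g * d h] in place of the
    multiplicativity of a morphism.

    A sigma-derivation [D] extending [f], pulled back along [pi], obeys the
    twisted Leibniz rule on [F(X)] and agrees with [f] on [X]; by uniqueness it
    is [ftilde] (lemma [sigma_derivation_fg_lift]).  A relator is mapped to [1]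
    by [pi], and [D 1 = 0], so [ftilde] kills the relators.

    Conversely, the words [w] with [pi w = 1] and [ftilde w = 0] form a normal
    subgroup ([normal_ftilde_ker]).  If [ftilde] kills [Y], this subgroup
    contains [Y], hence is all of [ker pi]; by the Leibniz rule [ftilde] is then
    constant on the fibres of [pi] and descends to a map [d] on [G]
    ([ftilde_descends]).  Since [G] is a basis of [RG], [d] extends to a linear
    map, and the Leibniz rule, whose two sides are bilinear, only has to be
    checked on [G] ([gr_ext_sigma_derivation]). *)

Section LinearExtension.
Variables (R : pzRingType) (G : groupType) (V : lmodType R).
Local Notation RG := (groupRing R G).

Definition gr_ext (phi : G -> V) (p : RG) : V :=
  \sum_(g <- msupp p) p@_g *: phi g.

(** Summing over any larger set allows elements with different supports to be
    compared term by term. *)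
Lemma gr_extw (phi : G -> V) (d : {fset G}) (p : RG) :
  (msupp p `<=` d)%fset -> gr_ext phi p = \sum_(g <- d) p@_g *: phi g.
Proof.
move=> le_d; rewrite /gr_ext (big_fset_incl _ le_d) //= => g _ /mcoeff_outdom ->.
by rewrite scale0r.
Qed.

Lemma gr_ext_linear (phi : G -> V) : linear (gr_ext phi).
Proof.
move=> c p q; pose d := (msupp p `|` msupp q)%fset.
have le_p : (msupp p `<=` d)%fset by apply: fsubsetUl.
have le_q : (msupp q `<=` d)%fset by apply: fsubsetUr.
have le_pq : (msupp (c *: p + q)%R `<=` d)%fset.
  apply: fsubset_trans (msuppD_le _ _) _.
  by apply: fsetSU; apply: gr_msuppZ_le.
rewrite (gr_extw _ le_pq) (gr_extw _ le_p) (gr_extw _ le_q).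
rewrite scaler_sumr -big_split /=; apply: eq_bigr => g _.
by rewrite mcoeffD gr_scaleE scalerDl scalerA.
Qed.

Lemma gr_ext_of (phi : G -> V) (g : G) : gr_ext phi (gr_of R g) = phi g.
Proof.
(* The support of [gr_of R g] is empty when [R] is trivial; only the inclusion
   in [{g}] is available in general. *)
by rewrite (gr_extw _ msuppU_le) big_seq_fset1 mcoeffUU scale1r.
Qed.

Lemma gr_linear_eq (A B : RG -> V) : linear A -> linear B ->
  (forall g, A (gr_of R g) = B (gr_of R g)) -> A =1 B.
Proof.
move=> linA linB eqAB p.
pose A' : {linear RG -> V} := HB.pack A (GRing.isLinear.Build _ _ _ _ A linA).
pose B' : {linear RG -> V} := HB.pack B (GRing.isLinear.Build _ _ _ _ B linB).
rewrite -[A]/(A' : RG -> V) -[B]/(B' : RG -> V) [p]gr_ofE !linear_sum.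
by apply: eq_bigr => g _; rewrite !linearZ; congr (_ *: _); apply: eqAB.
Qed.

End LinearExtension.

Section GroupDerivations.
Variables (R : comPzRingType) (G : groupType).
Local Notation RG := (groupRing R G).
Variables (s : {multiplicative G -> G}) (sigma : RG -> RG).
Hypothesis hsigma : linear_extension s sigma.

(** Both sides of the Leibniz rule are linear in each argument, the
    commutativity of [R] being what lets scalars cross the left factors; so
    the rule on basis elements is enough. *)
Lemma gr_ext_sigma_derivation (d : G -> RG) :
    (forall g h, d (g * h)%g = d g * gr_of R (s h) + gr_of R (s g) * d h) ->
  sigma_derivation sigma (gr_ext d).
Proof.
case: hsigma => linS _ sigmaG dM; split; first exact: gr_ext_linear.
have linD := gr_ext_linear d.
have scaleAr c (p q : RG) : p * (c *: q) = c *: (p * q).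
  by rewrite gr_scalerAr // => a; apply: mulrC.
move=> a b; move: a; apply: gr_linear_eq => [c p q|c p q|g].
- by rewrite mulrDl -gr_scalerAl linD.
- by rewrite linD linS !mulrDl -!gr_scalerAl scalerDr addrACA.
move: b; apply: gr_linear_eq => [c p q|c p q|h].
- by rewrite mulrDr scaleAr linD.
- by rewrite linD linS !mulrDr !scaleAr scalerDr addrACA.
by rewrite -gr_ofM !gr_ext_of !sigmaG dM.
Qed.

Lemma sigma_derivation1 (D : RG -> RG) : sigma_derivation sigma D -> D 1 = 0.
Proof.
case: hsigma => _ [sigma1 _] _ [_ DM].
have := DM 1 1; rewrite !mulr1 sigma1 mulr1 mul1r.
by move/(congr1 (fun z => z - D 1)); rewrite addrK subrr.
Qed.

End GroupDerivations.

Section MultiplicativeGroups.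
Variables (G H : groupType) (s : {multiplicative G -> H}).

Lemma multiplicative1 : s 1%g = 1%g.
Proof. by apply: (mulgI (s 1%g)); rewrite -gmulfM !mulg1. Qed.

Lemma multiplicativeV (x : G) : s x^-1%g = (s x)^-1%g.
Proof. by apply/esym/mulg1_eq; rewrite -gmulfM mulgV multiplicative1. Qed.

End MultiplicativeGroups.

Section Descent.
Variables (R : comPzRingType) (X : choiceType) (G : groupType).
Local Notation RG := (groupRing R G).
Variables (gen : X -> G) (s : {multiplicative G -> G}) (f : X -> RG).
Local Notation pi := (fg_lift gen).
Local Notation ft := (ftilde gen s f).

Lemma sigma_tildeE w : sigma_tilde gen s w = s (pi w).
Proof.
elim/fg_ind: w => [|x w IHw|x w IHw]; rewrite /sigma_tilde.
- by rewrite !gmulf1 multiplicative1.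
- by rewrite !gmulfM /= !fg_lift_gen -IHw.
by rewrite !gmulfM !gmulfV /= multiplicativeV !fg_lift_gen -IHw.
Qed.

Lemma ftilde_mul v w :
  ft (v * w)%g = ft v * gr_of R (s (pi w)) + gr_of R (s (pi v)) * ft w.
Proof. by rewrite ftildeM !sigma_tildeE. Qed.

Lemma sigma_derivation_fg_lift (sigma D : RG -> RG) :
    linear_extension s sigma -> sigma_derivation sigma D ->
    (forall x, D (gr_of R (gen x)) = f x) ->
  forall w, D (gr_of R (pi w)) = ft w.
Proof.
case=> _ _ sigmaG [_ DM] Df.
apply: (ftilde_unique (g := fun w => D (gr_of R (pi w)))) => [x|v w].
  by rewrite fg_lift_gen Df.
by rewrite gmulfM /= gr_ofM DM !sigmaG !sigma_tildeE.
Qed.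

(** [ftilde] is additive on [ker pi], and conjugation only multiplies its value
    there by group elements on both sides; this is why the condition
    [ftilde w = 0] is stable under conjugation on [ker pi], though not on the
    whole free group. *)
Lemma normal_ftilde_ker :
  normal_subgroup (fun w : freeGroup X => pi w = 1%g /\ ft w = 0).
Proof.
split=> [|v w [pv fv] [pw fw]|v [pv fv]|v w [pv fv]].
- by rewrite gmulf1 ftilde1.
- by rewrite gmulfM /= pv pw mulg1 ftilde_mul fv fw mul0r mulr0 addr0.
- rewrite gmulfV /= pv invg1; split=> //.
  have := ftilde_mul v v^-1%g.
  by rewrite mulgV ftilde1 fv pv multiplicative1 gr_of1 mul0r add0r mul1r.
rewrite gmulfJ /= pv conj1g conjgE; split=> //.
(* Deleting [v] from [w^-1 * (v * w)] leaves [ft] unchanged. *)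
rewrite ftilde_mul gmulfM /= ftilde_mul fv pv multiplicative1 gr_of1 mul1g.
by rewrite mul0r add0r mul1r -ftilde_mul mulVg ftilde1.
Qed.

Variable Y : freeGroup X -> Prop.
Hypothesis hG : is_presentation gen Y.

Lemma fg_lift_relator y : Y y -> pi y = 1%g.
Proof. by move=> Yy; apply/(hG.2 y) => N _; apply. Qed.

Hypothesis ftY : forall y, Y y -> ft y = 0.

Lemma ftilde_fiber v w : pi v = pi w -> ft v = ft w.
Proof.
move=> eq_vw; have pvw : pi (v * w^-1)%g = 1%g.
  by rewrite gmulfM gmulfV /= eq_vw mulgV.
have [] : pi (v * w^-1)%g = 1%g /\ ft (v * w^-1)%g = 0.
  apply: (proj1 (hG.2 _) pvw _ normal_ftilde_ker) => y Yy.
  by rewrite fg_lift_relator // ftY.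
move=> _ fvw; rewrite -[v](mulgVK w).
by rewrite ftilde_mul fvw pvw multiplicative1 gr_of1 mul0r mul1r add0r.
Qed.

Lemma ftilde_descends : exists d : G -> RG, forall w, d (pi w) = ft w.
Proof.
have surj g : exists w, pi w == g by have [w <-] := hG.1 g; exists w.
exists (fun g => ft (xchoose (surj g))) => w.
by apply: ftilde_fiber; apply/eqP; apply: (xchooseP (surj _)).
Qed.

End Descent.

Theorem theorem3p4 (X : choiceType) (G : groupType) (gen : X -> G)
    (Y : freeGroup X -> Prop) (hG : is_presentation gen Y)
    (R : comPzRingType) (s : {multiplicative G -> G})
    (sigma : groupRing R G -> groupRing R G)
    (hsigma : linear_extension s sigma) (f : X -> groupRing R G) :
  (exists D : groupRing R G -> groupRing R G,
      sigma_derivation sigma D /\ forall x, D (gr_of R (gen x)) = f x)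
  <-> (forall y, Y y -> ftilde gen s f y = 0).
Proof.
split=> [[D [derD Df]] y Yy|ftY].
  rewrite -(sigma_derivation_fg_lift hsigma derD Df) (fg_lift_relator hG Yy).
  by rewrite gr_of1 (sigma_derivation1 hsigma derD).
have [d dE] := ftilde_descends hG ftY.
exists (gr_ext d); split=> [|x].
  apply: (gr_ext_sigma_derivation hsigma) => g h.
  have [[v <-] [w <-]] := (hG.1 g, hG.1 h).
  by rewrite -gmulfM !dE ftilde_mul.
by rewrite gr_ext_of -(fg_lift_gen gen) dE ftilde_gen.
Qed.
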